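(* For all $v\in(0,1]$, $w\in(0,1]$ and $x\in\mathbb{N}_0$, $$\frac{Z_v(x,w)}{v}=\sum_{k=-1}^{x}p_{k+1}Z_v(x-k,w)+\sum_{k=x+1}^\infty w^{k-x}p_{k+1}.$$
   Context: Notation: $\mathbb{N}=\{1,2,\dots\}$, $\mathbb{N}_0=\{0,1,2,\dots\}$; $E[Y;A]:=E[Y\mathbf{1}_A]$; $\inf\emptyset=\infty$. Let $(p_k)_{k\in\mathbb{N}_0}$ be a probability mass function on $\mathbb{N}_0$ with $p_0>0$, and let $C_1,C_2,\dots$ be i.i.d. with $P(C_1=k)=p_k$. Let $X_n=X_0+n-\sum_{i=1}^nC_i$, $n\in\mathbb{N}_0$; for $x\in\mathbb{Z}$, $P_x$ (expectation $E_x$) is the law under which $X_0=x$, and $P=P_0$, $E=E_0$. For $b\in\mathbb{Z}$ let $\tau_b^-=\inf\{n\in\mathbb{N}_0:X_n\le b\}$ and $\tau_b^+=\inf\{n\in\mathbb{N}_0:X_n\ge b\}$. For $v\in(0,1]$: $W_v(y):=\big(p_0E[v^{\tau_y^+};\tau_y^+<\tau_{-1}^-]\big)^{-1}$ for $y\in\mathbb{N}_0$, and $W_v(y):=0$ for integers $y<0$. For $v,w\in(0,1]$ and $x\in\mathbb{Z}$: $\Psi_v(x,w):=E_x[v^{\tau_{-1}^-}w^{-X(\tau_{-1}^-)};\tau_{-1}^-<\infty]$ and $Z_v(x,w):=\Psi_v(x,w)+\alpha_v(w)W_v(x)$, where the constant $\alpha_v(w)\in[0,\infty)$ is chosen so that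 $Z_v(0,w)=1$. *)

(* Defs.v *)
From HB Require Import structures.
From mathcomp Require Import all_boot all_order all_algebra.
From mathcomp Require Import all_classical all_reals all_analysis.

Set Implicit Arguments.
Unset Strict Implicit.
Unset Printing Implicit Defensive.

Import Order.TTheory GRing.Theory Num.Theory.
Import numFieldNormedType.Exports.

Local Open Scope classical_set_scope.
Local Open Scope ring_scope.

Section Independence.
Context {d : measure_display} {T : measurableType d} {R : realType}.

(* The product rule over every finite subfamily; every subset of [nat] is
   measurable. *)
Definition mutually_independent (P : probability T R)
    (C : nat -> {mfun T >-> nat}) : Prop :=
  forall (s : seq nat) (B : nat -> set nat), uniq s ->
    P (\bigcap_(i in [set` s]) (C i @^-1` B i)) =
    (\prod_(i <- s) P (C i @^-1` B i))%E.

(* [C i] stands for the claim C_{i+1} of a sequence C_1, C_2, ... *)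
Definition iid_with_pmf (P : probability T R) (C : nat -> {mfun T >-> nat})
    (p : nat -> R) : Prop :=
  mutually_independent P C /\
  forall i k : nat, P (C i @^-1` [set k]) = (p k)%:E.

(* E[Y; A] = E[Y 1_A] as a real number; it is only used below for bounded
   nonnegative Y, for which the expectation is finite. *)
Definition expectation_on (P : probability T R) (Y : T -> R) (A : set T) : R :=
  fine 'E_P[fun t => Y t * \1_A t].

End Independence.

Section Walk.
Context {d : measure_display} {T : measurableType d} {R : realType}.
Variables (X0 : T -> int) (C : nat -> {mfun T >-> nat}).

Definition walk (n : nat) (t : T) : int :=
  X0 t + n%:Z - \sum_(i < n) (C i t)%:Z.

(* First passage times take values in the extended reals, so that
   [ereal_inf set0 = +oo] is the value of a passage time that never occurs. *)
Definition tau_minus (b : int) (t : T) : \bar R :=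
  ereal_inf [set n%:R%:E | n in [set n : nat | walk n t <= b]].

Definition tau_plus (b : int) (t : T) : \bar R :=
  ereal_inf [set n%:R%:E | n in [set n : nat | b <= walk n t]].

(* For a finite passage time, the natural number it equals. *)
Definition time_index (tau : \bar R) : nat := Num.truncn (fine tau).

Variables (P : int -> probability T R) (p : nat -> R).

Definition W (v : R) (y : int) : R :=
  if 0 <= y then
    (p 0%N * expectation_on (P 0)
       (fun t => v ^+ time_index (tau_plus y t))
       [set t | (tau_plus y t < tau_minus (-1) t)%E])^-1
  else 0.

Definition Psi (v : R) (x : int) (w : R) : R :=
  expectation_on (P x)
    (fun t => v ^+ time_index (tau_minus (-1) t) *
              w ^ (- walk (time_index (tau_minus (-1) t)) t))
    [set t | (tau_minus (-1) t < +oo)%E].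

(* The constant a in [0, oo) such that Psi_v(0, w) + a W_v(0) = 1. *)
Definition alpha (v w : R) : R :=
  xget 0 [set a : R | 0 <= a /\ Psi v 0 w + a * W v 0 = 1].

Definition Z (v : R) (x : int) (w : R) : R := Psi v x w + alpha v w * W v x.

End Walk.

(* Main.v *)
Require Import Defs.
From mathcomp Require Import all_boot all_order all_algebra.
From mathcomp Require Import all_classical all_reals all_analysis.
From mathcomp Require Import measurable_realfun.
From mathcomp Require Import zify ring.

Set Implicit Arguments.
Unset Strict Implicit.
Unset Printing Implicit Defensive.

Import Order.TTheory GRing.Theory Num.Theory.
Import numFieldNormedType.Exports.

Local Open Scope classical_set_scope.
Local Open Scope ring_scope.

(** The identity is linear in Z, and Z is Psi plus a multiple of W, so it is
enough to prove one identity for each summand, whatever the constant alpha is: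
Psi satisfies the stated relation with its tail term (lemma [Psi_step]), and W
satisfies the homogeneous relation without it ([scale_fun_step]).

Both come from the Markov property at time 1 for a stopped, discounted walk.
Given a stopping region and a reward, let V(x) be the expectation of v^tau
times the reward at time tau, for the walk started at x and stopped at its
first visit tau to the region. Outside the region V(x) = v E[V(X_1)]. Here V is
built without probability, as the increasing limit of the iterates of the
one-step operator started at 0 ([value]); its one-step equation is
[value_step]. The expectation under P_x is identified with V in
[expectation_value]: the N-th iterate integrates the payoff of the first N
jumps, by conditioning successively on cylinder sets of the i.i.d. jumps
([integral_payoff_cylinder]), and monotone convergence lets N go to infinity.

For Psi the region is the set of negative integers with reward w^(-z); jumps
larger than x + 1 land in the region and produce the tail series.

For W, let E_y(z) be the value of leaving [0, y) upwards, started from z. Since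
the walk goes up by at most one, it visits x before y, hence
E_y(z) = E_x(z) E_y(x) for 0 <= x <= y and z <= x ([exit_value_mul]). So
E_(x+1)(k) = E_(x+1)(0) / E_k(0) is proportional to W(k) for 0 <= k <= x + 1,
and the one-step equation of E_(x+1) at x is the relation for W. *)

(** * The one-step operator and the limit of its iterates *)

(** The walk at x moves to x + 1 - c when the next jump variable is c. *)
Definition hop (x : int) (c : nat) : int := x - (c%:Z - 1).

Section StepOperator.
Context {R : realType}.
Variables (p : nat -> R) (v : R).
Hypotheses (p_ge0 : forall k, 0 <= p k) (v_ge0 : 0 <= v).

(** v E[f(X_1)] for the walk started at x. *)
Definition step_mean (f : int -> \bar R) (x : int) : \bar R :=
  (v%:E * \sum_(0 <= j <oo) ((p j)%:E * f (hop x j)))%E.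

Lemma le_step_mean (f g : int -> \bar R) (x : int) :
    (forall z, 0 <= f z)%E ->
    (forall j : nat, f (hop x j) <= g (hop x j))%E ->
  (step_mean f x <= step_mean g x)%E.
Proof.
move=> f0 fg; apply: lee_wpmul2l; first by rewrite lee_fin.
apply: lee_nneseries => [j _ _|j _]; first by rewrite mule_ge0 ?lee_fin.
by rewrite lee_wpmul2l ?lee_fin.
Qed.

Lemma step_mean_ge0 (f : int -> \bar R) (x : int) :
  (forall z, 0 <= f z)%E -> (0 <= step_mean f x)%E.
Proof.
move=> f0; rewrite mule_ge0 ?lee_fin//; apply: nneseries_ge0 => j _ _.
by rewrite mule_ge0 ?lee_fin.
Qed.

Lemma step_meanZr (c : R) (f : int -> \bar R) (x : int) :
    (forall z, 0 <= f z)%E ->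
  (step_mean (fun z => f z * c%:E) x = step_mean f x * c%:E)%E.
Proof.
move=> f0; rewrite /step_mean -muleA; congr (_ * _)%E.
rewrite [RHS]muleC -nneseriesZl => [|j _]; last by rewrite mule_ge0 ?lee_fin.
by apply: eq_eseriesr => j _; rewrite muleA muleC.
Qed.

Section Value.
Variables (stop : pred int) (reward : int -> R).
Hypothesis reward_ge0 : forall z, 0 <= reward z.

Definition step (f : int -> \bar R) (x : int) : \bar R :=
  if stop x then (reward x)%:E else step_mean f x.

(** The N-th iterate counts only the rewards collected strictly before time N;
starting from 0 makes the sequence of iterates nondecreasing. *)
Definition value_upto (N : nat) : int -> \bar R := iter N step (cst 0%E).

Definition value (x : int) : \bar R := ereal_sup (range (value_upto ^~ x)).

Lemma value_uptoS N x : value_upto N.+1 x =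
  if stop x then (reward x)%:E else step_mean (value_upto N) x.
Proof. by []. Qed.

Lemma value_upto_ge0 N x : (0 <= value_upto N x)%E.
Proof.
elim: N x => [//|N IH] x; rewrite value_uptoS.
by case: ifP => _; rewrite ?lee_fin ?step_mean_ge0.
Qed.

Lemma le_value_uptoS N x : (value_upto N x <= value_upto N.+1 x)%E.
Proof.
elim: N x => [|N IH] x; first exact: value_upto_ge0.
rewrite (value_uptoS N) (value_uptoS N.+1); case: ifP => // _.
apply: le_step_mean => [z|j]; [exact: value_upto_ge0 | exact: IH].
Qed.

Lemma le_value_upto m n x : (m <= n)%N -> (value_upto m x <= value_upto n x)%E.
Proof.
move=> mn; elim: n mn => [|n IH]; first by rewrite leqn0 => /eqP ->.
rewrite leq_eqVlt ltnS => /predU1P[->//|/IH mn].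
exact: le_trans mn (le_value_uptoS n x).
Qed.

Lemma cvg_value x : value_upto N x @[N --> \oo] --> value x.
Proof. by apply: ereal_nondecreasing_cvgn => m n; apply: le_value_upto. Qed.

Lemma value_upto_le N x : (value_upto N x <= value x)%E.
Proof. by apply: ereal_sup_ubound; exists N. Qed.

Lemma value_ge0 x : (0 <= value x)%E.
Proof. exact: le_trans (value_upto_ge0 0 x) (value_upto_le 0 x). Qed.

Lemma value_stop x : stop x -> value x = (reward x)%:E.
Proof.
move=> sx; apply/eqP; rewrite eq_le; apply/andP; split; last first.
  by have := value_upto_le 1 x; rewrite value_uptoS sx.
apply: ub_ereal_sup => _ [[_ <-|N _ <-]]; first by rewrite lee_fin.
by rewrite value_uptoS sx.
Qed.

(** The bound from below exchanges the limit of the iterates with the jump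
series: each finite partial sum passes to the limit, and then the number of
terms goes to infinity. *)
Lemma value_step x : ~~ stop x -> value x = step_mean value x.
Proof.
move=> /negbTE sx; apply/eqP; rewrite eq_le; apply/andP; split.
  apply: ub_ereal_sup => _ [[_ <-|N _ <-]].
    exact/step_mean_ge0/value_ge0.
  rewrite value_uptoS sx; apply: le_step_mean => [z|j].
    exact: value_upto_ge0.
  exact: value_upto_le.
have lim_le M : (v%:E * \sum_(0 <= j < M) ((p j)%:E * value (hop x j))
    <= value x)%E.
  have cv : (v%:E * \sum_(0 <= j < M)
        ((p j)%:E * value_upto N (hop x j)))%E @[N --> \oo] -->
      (v%:E * \sum_(0 <= j < M) ((p j)%:E * value (hop x j)))%E.
    apply: cvgeZl => //; apply: cvg_nnesum => j _.
      by apply: nearW => N; rewrite mule_ge0 ?lee_fin ?value_upto_ge0.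
    by apply: cvgeZl => //; exact: cvg_value.
  rewrite -(cvg_lim _ cv)//; apply: lime_le.
    by apply/cvg_ex; eexists; exact: cv.
  apply: nearW => N; apply: le_trans (value_upto_le N.+1 x).
  rewrite value_uptoS sx lee_wpmul2l ?lee_fin//.
  apply: nneseries_lim_ge => j _ _.
  by rewrite mule_ge0 ?lee_fin ?(value_upto_ge0 N).
have pv0 (j : nat) : (0 <= (p j)%:E * value (hop x j))%E.
  by rewrite mule_ge0 ?lee_fin ?value_ge0.
have cv : (v%:E * \sum_(0 <= j < M) ((p j)%:E * value (hop x j)))%E
    @[M --> \oo] --> step_mean value x.
  by apply: cvgeZl => //; apply: is_cvg_nneseries.
rewrite -(cvg_lim _ cv)//; apply: lime_le; last exact: nearW.
by apply/cvg_ex; eexists; exact: cv.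
Qed.

(** The constant 1 is superharmonic, hence bounds every iterate. *)
Lemma value_le1 x : (\sum_(0 <= k <oo) (p k)%:E = 1)%E -> v <= 1 ->
  (forall z, stop z -> reward z <= 1) -> (value x <= 1)%E.
Proof.
move=> p1 v1 r1; apply: ub_ereal_sup => _ [N _ <-].
elim: N x => [|N IH] x; first by rewrite lee_fin.
rewrite value_uptoS; case: ifP => [sx|_]; first by rewrite lee_fin r1.
apply: (@le_trans _ _ (step_mean (cst 1%E) x)).
  by apply: le_step_mean => [z|j]; [exact: value_upto_ge0 | exact: IH].
rewrite /step_mean; under eq_eseriesr do rewrite mule1.
by rewrite p1 mule1 lee_fin.
Qed.

End Value.
End StepOperator.

(** * Two-sided exit and the scale function *)

Section TwoSidedExit.
Context {R : realType}.
Variables (p : nat -> R) (v : R).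
Hypotheses (p_ge0 : forall k, 0 <= p k)
  (p_sum1 : (\sum_(0 <= k <oo) (p k)%:E = 1)%E) (p0_gt0 : 0 < p 0%N)
  (v_gt0 : 0 < v) (v_le1 : v <= 1).

Let v_ge0 : 0 <= v := ltW v_gt0.

Definition exit_stop (y z : int) : bool := (z < 0) || (y <= z).

Definition exit_reward (y z : int) : R := (y <= z)%R%:R.

(** E[v^tau; the walk from z leaves [0, y) upwards, at time tau]. *)
Definition exit_value (y : int) : int -> \bar R :=
  value p v (exit_stop y) (exit_reward y).

Lemma exit_reward_ge0 y z : 0 <= exit_reward y z.
Proof. exact: ler0n. Qed.

Lemma exit_reward_le1 y z : exit_reward y z <= 1.
Proof. by rewrite /exit_reward lern1 leq_b1. Qed.

Lemma exit_value_ge0 y z : (0 <= exit_value y z)%E.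
Proof. exact/value_ge0/exit_reward_ge0. Qed.

Lemma exit_value_le1 y z : (exit_value y z <= 1)%E.
Proof. by apply: value_le1 => // t _; exact: exit_reward_le1. Qed.

Lemma exit_value_fin y z : exit_value y z \is a fin_num.
Proof.
rewrite ge0_fin_numE ?exit_value_ge0//.
exact: le_lt_trans (exit_value_le1 y z) (ltry _).
Qed.

Lemma exit_value_neg y z : 0 <= y -> z < 0 -> exit_value y z = 0%E.
Proof.
move=> y0 z0; rewrite /exit_value value_stop//; last by rewrite /exit_stop z0.
by rewrite /exit_reward leNgt (lt_le_trans z0).
Qed.

Lemma exit_value_top y z : y <= z -> exit_value y z = 1%E.
Proof.
move=> yz; rewrite /exit_value value_stop//; last by rewrite /exit_stop yz orbT.
by rewrite /exit_reward yz.
Qed.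

Lemma exit_value_step y z : 0 <= z < y ->
  exit_value y z = step_mean p v (exit_value y) z.
Proof.
move=> /andP[z0 zy]; rewrite /exit_value value_step//.
by rewrite /exit_stop negb_or -leNgt z0 -ltNge.
Qed.

(** To reach y from z <= x, a walk with upward steps of size at most one first
visits x. Analytically, below x both sides satisfy the same one-step equation,
and each inequality follows by induction on the iterates of the value on its
smaller side: a step from below x never lands above x, so the induction stays
in the range z <= x. *)
Lemma exit_value_mul (x y z : int) : 0 <= x <= y -> z <= x ->
  exit_value y z = (exit_value x z * exit_value y x)%E.
Proof.
move=> /andP[x0 xy].
have cE : exit_value y x = (fine (exit_value y x))%:E.
  by rewrite fineK ?exit_value_fin.
have y0 : 0 <= y by exact: le_trans x0 xy.
have hop_le (t : int) j : t < x -> hop t j <= x by rewrite /hop; lia.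
move=> zx; apply/eqP; rewrite eq_le; apply/andP; split.
  apply: ub_ereal_sup => _ [N _ <-].
  elim: N z zx => [|N IH] z zx; first by rewrite mule_ge0 ?exit_value_ge0.
  have [z0|z0] := ltP z 0.
    rewrite exit_value_neg// mul0e -(exit_value_neg y0 z0).
    exact/value_upto_le.
  move: zx; rewrite (le_eqVlt z) => /predU1P [->|zx].
    by rewrite (exit_value_top (lexx x)) mul1e; exact: value_upto_le.
  have zy : z < y by exact: lt_le_trans zx xy.
  rewrite value_uptoS /exit_stop ltNge z0 [y <= z]leNgt zy /=.
  rewrite [in leRHS]exit_value_step ?z0// cE -step_meanZr//; last first.
    exact: exit_value_ge0.
  apply: le_step_mean => // [t|j]; first exact/value_upto_ge0/exit_reward_ge0.
  by rewrite -cE; apply/IH/hop_le.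
have: (forall N, value_upto p v (exit_stop x) (exit_reward x) N z *
    exit_value y x <= exit_value y z)%E.
  move=> N; elim: N z zx => [|N IH] z zx; first by rewrite mul0e exit_value_ge0.
  rewrite value_uptoS /exit_stop; have [z0|z0] /= := ltP z 0.
    by rewrite /exit_reward [x <= z]leNgt (lt_le_trans z0 x0) mul0e exit_value_ge0.
  move: zx; rewrite (le_eqVlt z) => /predU1P [->|zx].
    by rewrite lexx /exit_reward lexx mul1e.
  have zy : z < y by exact: lt_le_trans zx xy.
  rewrite [x <= z]leNgt zx/= [leRHS]exit_value_step ?z0// cE -step_meanZr//; last first.
    exact/value_upto_ge0/exit_reward_ge0.
  apply: le_step_mean => // [t|j].
    by rewrite mule_ge0 ?value_upto_ge0 ?lee_fin ?fine_ge0 ?exit_value_ge0//;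
      exact: exit_reward_ge0.
  by rewrite -cE; apply/IH/hop_le.
move=> h; have cv : (value_upto p v (exit_stop x) (exit_reward x) N z *
    exit_value y x)%E @[N --> \oo] --> (exit_value x z * exit_value y x)%E.
  by apply: cvgeZr; [exact: exit_value_fin | exact/cvg_value/exit_reward_ge0].
rewrite -(cvg_lim _ cv)//; apply: lime_le; last exact: nearW.
by apply/cvg_ex; eexists; exact: cv.
Qed.

(** The walk may go straight up to y, because p_0 > 0. *)
Lemma exit_value_gt0 y z : 0 <= z -> (0 < exit_value y z)%E.
Proof.
move=> z0; have [n] : {n : nat | y <= z + n%:Z}.
  by exists `|y - z|%N; lia.
elim: n z z0 => [|n IH] z z0 yz.
  by rewrite exit_value_top ?lte_fin//; move: yz; rewrite addr0.
have [zy|yz'] := ltP z y; last by rewrite exit_value_top ?lte_fin.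
rewrite exit_value_step ?z0// mule_gt0 ?lte_fin//.
have hz : hop z 0 = z + 1 by rewrite /hop; lia.
apply: (@lt_le_trans _ _ ((p 0%N)%:E * exit_value y (hop z 0))%E).
  rewrite mule_gt0 ?lte_fin// hz; apply: IH; first by rewrite addr_ge0.
  by move: yz; lia.
apply: le_trans (nneseries_lim_ge 1 _) => [|j _ _].
  by rewrite big_nat1.
by rewrite mule_ge0 ?lee_fin ?exit_value_ge0.
Qed.

(** The function W, with its expectation replaced by the value [exit_value]. *)
Definition scale_fun (y : int) : R :=
  if 0 <= y then (p 0%N * fine (exit_value y 0))^-1 else 0.

(** The one-step equation of [exit_value] for the level x + 1 at the point x,
divided by exit_value (x + 1) 0. The walk is below the level x + 1
at x, and every nonnegative point reached from x in one step is at or below this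
level, so that [exit_value_mul] applies to it. *)
Lemma scale_fun_step (x : nat) :
  scale_fun x%:Z / v = \sum_(0 <= j < x.+2) p j * scale_fun (hop x%:Z j).
Proof.
pose e y z := fine (exit_value y z).
have eE y z : exit_value y z = (e y z)%:E by rewrite fineK ?exit_value_fin.
have e_gt0 (y z : int) : 0 <= z -> 0 < e y z.
  by move=> z0; rewrite -lte_fin -eE exit_value_gt0.
have e_mul (k : int) : 0 <= k <= x%:Z + 1 ->
    e (x%:Z + 1) k = e (x%:Z + 1) 0 / e k 0.
  move=> kx; have k0 : 0 <= k by case/andP: kx.
  have := exit_value_mul kx k0; rewrite !eE => -[->].
  by rewrite mulrC mulKf// gt_eqF ?e_gt0.
have eS : e (x%:Z + 1) x%:Z =
    v * \sum_(0 <= j < x.+2) p j * e (x%:Z + 1) (hop x%:Z j).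
  have := @exit_value_step (x%:Z + 1) x%:Z; rewrite {1}eE => H.
  apply: EFin_inj; rewrite {}H; last by lia.
  rewrite /step_mean (nneseries_split 0 x.+2) => [|j _]; last first.
    by rewrite mule_ge0 ?lee_fin ?exit_value_ge0.
  (* A jump of size at least x + 2 leads below 0, where the exit value is 0. *)
  rewrite add0n eseries0 => [|j xj _]; last first.
    by rewrite exit_value_neg ?mule0// /hop; lia.
  rewrite adde0 EFinM -sumEFin; congr (_ * _)%E.
  by apply: eq_bigr => j _; rewrite eE.
have eN0 (y z : int) : 0 <= z -> e y z != 0.
  by move=> z0; rewrite gt_eqF ?e_gt0.
rewrite e_mul in eS; last by lia.
have : scale_fun x%:Z = v * \sum_(0 <= j < x.+2) p j * scale_fun (hop x%:Z j).
  rewrite {1}/scale_fun /= -/(e _ _) invfM.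
  have -> : (e x 0)^-1 = (e (x%:Z + 1) 0 / e x 0) * (e (x%:Z + 1) 0)^-1.
    by field; rewrite !eN0.
  rewrite eS -mulrA mulrCA; congr (_ * _); rewrite mulr_suml mulr_sumr.
  rewrite !big_nat; apply: eq_bigr => j jx.
  have h0 : 0 <= hop x%:Z j by rewrite /hop; lia.
  rewrite /scale_fun h0 -/(e _ _) e_mul; last by rewrite /hop; lia.
  by field; rewrite !eN0//= gt_eqF.
by move=> ->; rewrite mulrAC divff ?mul1r// gt_eqF.
Qed.

End TwoSidedExit.

(** * Payoff along a deterministic sequence of jumps *)

Section Payoff.
Context {R : realType}.
Variables (v : R) (stop : pred int) (reward : int -> R).
Hypotheses (v_ge0 : 0 <= v) (reward_ge0 : forall z, 0 <= reward z).

(** The discounted reward collected along the finite sequence s of jumps. It is 0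
on an empty sequence even at a stopping point, so that the payoff of N jumps
corresponds to the N-th iterate [value_upto]. *)
Fixpoint payoff (z : int) (s : seq nat) : R :=
  if s is c :: s' then
    if stop z then reward z else v * payoff (hop z c) s'
  else 0.

Lemma payoff_ge0 z s : 0 <= payoff z s.
Proof. by elim: s z => //= c s IH z; case: ifP => // _; rewrite mulr_ge0. Qed.

Lemma payoff_cat z s s' : payoff z s <= payoff z (s ++ s').
Proof.
elim: s z => [|c s IH] z /=; first exact: payoff_ge0.
by case: ifP => // _; exact: ler_wpM2l.
Qed.

Definition position (z : int) (c : nat -> nat) (n : nat) : int :=
  z + n%:Z - \sum_(i < n) (c i)%:Z.

Lemma position0 z c : position z c 0 = z.
Proof. by rewrite /position big_ord0 subr0 addr0. Qed.

Lemma positionS z c n :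
  position z c n.+1 = position (hop z (c 0%N)) (c \o succn) n.
Proof.
rewrite /position /hop big_ord_recl.
have -> : \sum_(i < n) (c (lift ord0 i))%:Z =
  \sum_(i < n) ((c \o succn) i)%:Z by apply: eq_bigr.
by rewrite /= -addn1 PoszD; ring.
Qed.

Lemma mkseqS_cons (c : nat -> nat) N :
  mkseq c N.+1 = c 0%N :: mkseq (c \o succn) N.
Proof. by rewrite /mkseq /= (iotaDl 1 0 N) -map_comp. Qed.

Lemma payoff_unstopped z c N :
  (forall n, (n < N)%N -> ~~ stop (position z c n)) ->
  payoff z (mkseq c N) = 0.
Proof.
elim: N z c => [//|N IH] z c ns; rewrite mkseqS_cons /=.
have := ns 0%N isT; rewrite position0 => /negbTE ->.
by rewrite IH ?mulr0// => n nN; rewrite -positionS ns.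
Qed.

Lemma payoff_stopped z c n N : (n < N)%N -> stop (position z c n) ->
  (forall m, (m < n)%N -> ~~ stop (position z c m)) ->
  payoff z (mkseq c N) = v ^+ n * reward (position z c n).
Proof.
elim: N z c n => [//|N IH] z c [|n] nN; rewrite mkseqS_cons /=.
  by rewrite position0 => -> _; rewrite expr0 mul1r.
rewrite positionS => sn ns.
have := ns 0%N isT; rewrite position0 => /negbTE ->.
rewrite (IH _ _ n)// ?exprS ?mulrA// => m mn.
by rewrite -positionS ns.
Qed.

Lemma cvg_payoff_unstopped z c : (forall n, ~~ stop (position z c n)) ->
  payoff z (mkseq c N) @[N --> \oo] --> (0 : R).
Proof.
move=> ns; rewrite (_ : (fun _ => _) = cst 0); first exact: cvg_cst.
by apply/funext => N; rewrite payoff_unstopped.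
Qed.

Lemma cvg_payoff_stopped z c n : stop (position z c n) ->
  (forall m, (m < n)%N -> ~~ stop (position z c m)) ->
  payoff z (mkseq c N) @[N --> \oo] --> v ^+ n * reward (position z c n).
Proof.
move=> sn ns; apply: cvg_near_cst; exists n.+1 => // N /= nN.
exact: payoff_stopped.
Qed.

End Payoff.

(** * Measurability and integration of functions of finitely many jumps *)

Section CountableRange.
Context {d : measure_display} {T : measurableType d}.

Lemma measurable_preimage_count (U : countType) (g : T -> U) (B : set U) :
  (forall u, measurable (g @^-1` [set u])) -> measurable (g @^-1` B).
Proof.
move=> mg; rewrite (_ : _ @^-1` _ = \bigcup_u (g @^-1` ([set u] `&` B))).
  apply: countable_bigcupT_measurable => // u.
  have [Bu|Bu] := pselect (B u).
    by rewrite setIidl// => _ ->.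
  rewrite (_ : _ `&` _ = set0) ?preimage_set0//.
  by apply/seteqP; split => // _ [-> /Bu].
apply/seteqP; split => [t Bt|t [u _ [_]]//].
by exists (g t).
Qed.

Lemma measurable_fun_count {R : realType} (U : countType) (g : T -> U)
    (F : U -> R) (D : set T) : (forall u, measurable (g @^-1` [set u])) ->
  measurable_fun D (F \o g).
Proof.
move=> mg mD Y _; apply: measurableI => //; rewrite comp_preimage.
exact: measurable_preimage_count.
Qed.

Lemma measurable_fiber_map (C : nat -> {mfun T >-> nat}) k N s :
  measurable ((fun t => [seq C i t | i <- iota k N]) @^-1` [set s]).
Proof.
elim: N k s => [|N IH] k [|c s] /=.
- by rewrite (_ : _ @^-1` _ = setT)//; apply/seteqP.
- by rewrite (_ : _ @^-1` _ = set0)//; apply/seteqP; split.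
- by rewrite (_ : _ @^-1` _ = set0)//; apply/seteqP; split.
rewrite (_ : _ @^-1` _ = C k @^-1` [set c] `&`
  (fun t => [seq C i t | i <- iota k.+1 N]) @^-1` [set s]).
  by apply: measurableI => //; exact: measurable_funPTI.
by apply/seteqP; split => t /=; [case=> -> -> | case=> -> ->].
Qed.

End CountableRange.

Section Cylinder.
Context {d : measure_display} {T : measurableType d} {R : realType}.
Variables (P : probability T R) (C : nat -> {mfun T >-> nat}) (p : nat -> R).
Hypotheses (p_ge0 : forall k, 0 <= p k) (C_iid : iid_with_pmf P C p).

Definition cylinder (b : seq nat) : set T :=
  [set t | [seq C i t | i <- iota 0 (size b)] = b].

Lemma measurable_cylinder b : measurable (cylinder b).
Proof. exact: measurable_fiber_map. Qed.

Lemma cylinder_rcons b c :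
  cylinder (rcons b c) = cylinder b `&` C (size b) @^-1` [set c].
Proof.
have E t : [seq C i t | i <- iota 0 (size (rcons b c))] =
    rcons [seq C i t | i <- iota 0 (size b)] (C (size b) t).
  by rewrite size_rcons -addn1 iotaD map_cat cats1.
apply/seteqP; split => t; rewrite /cylinder /= E.
  by move=> /rcons_inj[].
by move=> [-> ->].
Qed.

Lemma prob_cylinder b : P (cylinder b) = (\prod_(j <- b) (p j)%:E)%E.
Proof.
have [ind law] := C_iid.
have -> : cylinder b =
    \bigcap_(i in [set` iota 0 (size b)]) C i @^-1` [set nth 0%N b i].
  apply/seteqP; split => t.
    rewrite /cylinder /= => E i /=; rewrite mem_iota /= add0n => ib.
    by rewrite -[in RHS]E (nth_map 0%N) ?size_iota// nth_iota.
  move=> H; apply: (@eq_from_nth _ 0%N); first by rewrite size_map size_iota.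
  move=> i; rewrite size_map size_iota => ib.
  rewrite (nth_map 0%N) ?size_iota// nth_iota// add0n.
  by apply: (H i); rewrite /= mem_iota.
rewrite (ind _ (fun i => [set nth 0%N b i])) ?iota_uniq//.
rewrite [RHS](big_nth 0%N) /index_iota subn0.
by apply: eq_bigr => i _; rewrite law.
Qed.

Lemma bigcup_cylinder_rcons b : \bigcup_c cylinder (rcons b c) = cylinder b.
Proof.
apply/seteqP; split => [t [c _]|t bt]; first by rewrite cylinder_rcons => -[].
by exists (C (size b) t) => //; rewrite cylinder_rcons.
Qed.

Lemma trivIset_cylinder_rcons b :
  trivIset [set: nat] (fun c => cylinder (rcons b c)).
Proof.
by move=> c c' _ _ [t []]; rewrite !cylinder_rcons => -[_ <-] [_ <-].
Qed.

Variables (v : R) (stop : pred int) (reward : int -> R).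
Hypotheses (v_ge0 : 0 <= v) (reward_ge0 : forall z, 0 <= reward z).

Lemma measurable_payoff z k N (D : set T) :
  measurable_fun D
    ((fun t => (payoff v stop reward z [seq C i t | i <- iota k N])%:E)
      : T -> \bar R).
Proof.
apply/measurable_EFinP.
apply: (measurable_fun_count (payoff v stop reward z)).
exact: measurable_fiber_map.
Qed.

(** The Markov property in the form needed: given the first jumps b, the
remaining ones have the product law. Putting an arbitrary cylinder in the
statement makes the induction on N go through, since fixing one more jump turns
the cylinder of b into the cylinders of its one-letter extensions. *)
Lemma integral_payoff_cylinder z b N :
  (\int[P]_(t in cylinder b)
     (payoff v stop reward z [seq C i t | i <- iota (size b) N])%:E =
   P (cylinder b) * value_upto p v stop reward N z)%E.
Proof.
elim: N z b => [|N IH] z b.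
  by rewrite mule0 /= integral0.
rewrite value_uptoS /=; case: ifPn => sz.
  by rewrite muleC; apply: integral_cst; exact: measurable_cylinder.
rewrite -{1}bigcup_cylinder_rcons ge0_integral_bigcup//; first last.
- exact: trivIset_cylinder_rcons.
- by move=> t _; rewrite lee_fin mulr_ge0// payoff_ge0.
- rewrite bigcup_cylinder_rcons.
  have := @measurable_payoff z (size b) N.+1 (cylinder b).
  by rewrite /= (negbTE sz).
- by move=> c; exact: measurable_cylinder.
have H c : (\int[P]_(t in cylinder (rcons b c))
    (v * payoff v stop reward (hop z (C (size b) t))
           [seq C i t | i <- iota (size b).+1 N])%:E =
    (fine (P (cylinder b)) * v)%:E *
      ((p c)%:E * value_upto p v stop reward N (hop z c)))%E.
  transitivity (\int[P]_(t in cylinder (rcons b c)) (v%:E *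
    (payoff v stop reward (hop z c)
           [seq C i t | i <- iota (size (rcons b c)) N])%:E))%E.
    apply: eq_integral => t; rewrite inE cylinder_rcons => -[_ /= ->].
    by rewrite size_rcons EFinM.
  rewrite ge0_integralZl//; first last.
  - by move=> t _; rewrite lee_fin payoff_ge0.
  - exact: measurable_payoff.
  - exact: measurable_cylinder.
  rewrite IH prob_cylinder -cats1 big_cat /= big_seq1 -prob_cylinder EFinM.
  rewrite fineK ?fin_num_measure//; last exact: measurable_cylinder.
  by rewrite !muleA; congr (_ * _ * _)%E; rewrite muleC.
under eq_eseriesr do rewrite H.
rewrite nneseriesZl => [|c _]; last first.
  by rewrite mule_ge0 ?lee_fin ?value_upto_ge0.
rewrite EFinM fineK ?fin_num_measure ?muleA//; exact: measurable_cylinder.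
Qed.

End Cylinder.

(** * From values to expectations *)

Section Expectation.
Context {d : measure_display} {T : measurableType d} {R : realType}.
Variables (P : probability T R) (X0 : T -> int) (C : nat -> {mfun T >-> nat}).
Variables (p : nat -> R) (x : int).
Hypotheses (p_ge0 : forall k, 0 <= p k) (C_iid : iid_with_pmf P C p).
Hypotheses (X0_measurable : forall z, measurable (X0 @^-1` [set z]))
  (X0_start : P (X0 @^-1` [set x]) = 1%E).
Variables (v : R) (stop : pred int) (reward : int -> R).
Hypotheses (v_ge0 : 0 <= v) (reward_ge0 : forall z, 0 <= reward z).

(** Y is only required to be the pathwise limit of the payoffs from the actual
starting point; this also makes Y measurable, and under P the starting point is
almost surely x. *)
Lemma expectation_value (Y : T -> R) :
    (forall t, payoff v stop reward (X0 t) (mkseq (C ^~ t) N) @[N --> \oo]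
      --> Y t) ->
  ('E_P[Y] = value p v stop reward x)%E.
Proof.
move=> cvgY.
pose g N t := (payoff v stop reward x (mkseq (C ^~ t) N))%:E.
have g_ndec t : {homo g ^~ t : m n / (m <= n)%N >-> (m <= n)%E}.
  move=> m n mn; rewrite lee_fin /mkseq -(subnKC mn) iotaD map_cat.
  exact: payoff_cat.
have mg N (D : set T) : measurable_fun D (g N) by exact: measurable_payoff.
have mY : measurable_fun setT Y.
  apply: (@measurable_fun_cvg _ _ _ _ (fun N t =>
    payoff v stop reward (X0 t) (mkseq (C ^~ t) N))) => // N.
  apply: (@measurable_fun_count _ _ _ _ (fun t => (X0 t, mkseq (C ^~ t) N))
    (fun u => payoff v stop reward u.1 u.2)) => -[z s].
  rewrite (_ : _ @^-1` _ = X0 @^-1` [set z] `&`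
    (fun t => mkseq (C ^~ t) N) @^-1` [set s]).
    by apply: measurableI => //; exact: measurable_fiber_map.
  by apply/seteqP; split => t /=; [case=> -> -> | case=> -> ->].
rewrite unlock.
transitivity (\int[P]_t limn (g ^~ t))%E.
  apply: ae_eq_integral => //.
  - exact/measurable_EFinP.
  - apply: (@emeasurable_fun_cvg _ _ _ _ g) => // t _.
    exact: ereal_nondecreasing_is_cvgn.
  exists (~` (X0 @^-1` [set x])); split.
  - exact: measurableC.
  - apply: (eq_trans (probability_setC P (X0_measurable x))).
    by rewrite X0_start subee.
  move=> t /= H Xt; apply: H => _; apply/esym/cvg_lim => //.
  by apply: cvg_EFin; [exact: nearW | by have := cvgY t; rewrite Xt].
rewrite monotone_convergence//; last first.
  by move=> N t _; rewrite lee_fin payoff_ge0.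
apply/cvg_lim => //.
rewrite (_ : (fun _ => _) = value_upto p v stop reward ^~ x).
  exact: cvg_value.
apply/funext => N; have := integral_payoff_cylinder p_ge0 C_iid stop
  v_ge0 reward_ge0 x [::] N.
rewrite (_ : cylinder C [::] = setT); last exact/seteqP.
by rewrite probability_setT mul1e.
Qed.

End Expectation.

(** * First passage times *)

Section FirstHit.
Context {R : realType}.
Implicit Types Q : pred nat.

Lemma first_or_never Q :
  (exists2 n, Q n & forall m, (m < n)%N -> ~~ Q m) \/ (forall n, ~~ Q n).
Proof.
have [exQ|noQ] := pselect (exists n, Q n); last first.
  by right=> n; apply/negP => Qn; apply: noQ; exists n.
left; case: (ex_minnP exQ) => n Qn nmin; exists n => // m mn.
by apply/negP => /nmin; rewrite leqNgt mn.
Qed.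

Definition first_hit Q : \bar R :=
  ereal_inf [set n%:R%:E | n in [set n : nat | Q n]].

Lemma first_hit_le Q n : Q n -> (first_hit Q <= n%:R%:E)%E.
Proof. by move=> Qn; apply: ereal_inf_lbound; exists n. Qed.

Lemma first_hit_ge Q n : (forall m, (m < n)%N -> ~~ Q m) ->
  (n%:R%:E <= first_hit Q)%E.
Proof.
move=> nQ; apply: le_ereal_inf_tmp => _ [m /= Qm <-].
rewrite lee_fin ler_nat leqNgt; apply/negP => /nQ.
by rewrite Qm.
Qed.

Lemma first_hitE Q n : Q n -> (forall m, (m < n)%N -> ~~ Q m) ->
  first_hit Q = n%:R%:E.
Proof.
by move=> Qn nQ; apply/eqP; rewrite eq_le first_hit_le// first_hit_ge.
Qed.

Lemma first_hit_never Q : (forall n, ~~ Q n) -> first_hit Q = +oo%E.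
Proof.
move=> nQ; rewrite /first_hit (_ : [set n | Q n] = set0).
  by rewrite image_set0 ereal_inf0.
by apply/seteqP; split => // n /= Qn; have := nQ n; rewrite Qn.
Qed.

Lemma time_index_nat (n : nat) : time_index (n%:R%:E : \bar R) = n.
Proof. by rewrite /time_index /= natrK. Qed.

End FirstHit.

Section PassageTimes.
Context {d : measure_display} {T : measurableType d} {R : realType}.
Variables (p : nat -> R).
Hypotheses (p_ge0 : forall k : nat, 0 <= p k).
Variables (X0 : T -> int) (C : nat -> {mfun T >-> nat})
  (P : int -> probability T R).
Hypotheses (X0_measurable : forall z : int, measurable (X0 @^-1` [set z]))
  (X0_start : forall x : int, P x (X0 @^-1` [set x]) = 1%E)
  (C_iid : forall x : int, iid_with_pmf (P x) C p).
Variables (v : R).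
Hypothesis v_gt0 : 0 < v.

(** The walk is stopped when it leaves [0, y). At that time n exactly one of the
two passages has occurred, since y >= 0, and tau_y^+ < tau_(-1)^- holds exactly
when it is the upward one. *)
Lemma WE (y : int) : W X0 C P p v y = scale_fun p v y.
Proof.
rewrite /W /scale_fun; case: ifP => // y0.
rewrite /expectation_on; congr (_ * fine _)^-1.
apply: (expectation_value p_ge0 (C_iid 0) X0_measurable (X0_start 0) (ltW v_gt0)).
  exact: exit_reward_ge0.
move=> t; pose Q n := exit_stop y (walk X0 C n t).
pose Qm n := walk X0 C n t <= -1.
pose Qp n := y <= walk X0 C n t.
have nQp n : ~~ Q n -> ~~ Qp n by rewrite negb_or => /andP[].
have nQm n : ~~ Q n -> ~~ Qm n.
  by rewrite negb_or => /andP[+ _]; rewrite /Qm; lia.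
set A := [set _ | _].
have tA : A t = (first_hit Qp < first_hit Qm :> \bar R)%E by [].
rewrite -[tau_plus X0 C y t]/(first_hit Qp).
have [[n Qn nQ]|nQ] := first_or_never Q; last first.
  rewrite indicE memNset ?mulr0; first exact: cvg_payoff_unstopped.
  rewrite tA (first_hit_never (Q := Qp)) ?ltNge ?leey//.
  by move=> n; exact: nQp.
suff -> : v ^+ time_index (first_hit Qp : \bar R) * \1_A t =
    v ^+ n * exit_reward y (walk X0 C n t) by exact: cvg_payoff_stopped.
have [yn|yn] := lerP y (walk X0 C n t).
  have Qpn : first_hit Qp = n%:R%:E :> \bar R.
    by apply: first_hitE => // m mn; exact/nQp/nQ.
  rewrite Qpn time_index_nat indicE mem_set ?/exit_reward ?yn//.
  rewrite tA Qpn; apply: (@lt_le_trans _ _ n.+1%:R%:E).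
    by rewrite lte_fin ltr_nat.
  apply: first_hit_ge => m; rewrite ltnS leq_eqVlt => /predU1P[->|mn].
    by rewrite /Qm; lia.
  exact/nQm/nQ.
have Qmn : Qm n by move: Qn; rewrite /Q /exit_stop leNgt yn orbF /Qm; lia.
rewrite indicE memNset ?/exit_reward 1?leNgt ?yn ?mulr0//.
rewrite tA; apply/negP; rewrite -leNgt.
apply: le_trans (first_hit_le Qmn) _; apply: first_hit_ge => m mn.
exact/nQp/nQ.
Qed.

Variables (w : R).
Hypothesis w_gt0 : 0 < w.

Definition ruin_stop (z : int) : bool := z <= -1.

Definition ruin_value : int -> \bar R :=
  value p v ruin_stop (fun z => w ^ (- z)).

(** Along each path, the integrand of Psi is the limit of the payoffs for the
region z <= -1 and the reward w^(-z). *)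
Lemma PsiE (x : int) : Psi X0 C P v x w = fine (ruin_value x).
Proof.
rewrite /Psi /expectation_on; congr fine.
apply: (expectation_value p_ge0 (C_iid x) X0_measurable (X0_start x) (ltW v_gt0)).
  by move=> z; rewrite exprz_ge0// ltW.
move=> t; pose Q n := walk X0 C n t <= -1.
rewrite -[tau_minus X0 C (-1) t]/(first_hit Q).
have [[n Qn nQ]|nQ] := first_or_never Q.
  rewrite (first_hitE Qn nQ) time_index_nat indicE mem_set ?mulr1.
    exact: cvg_payoff_stopped.
  by rewrite /= -[tau_minus X0 C (-1) t]/(first_hit Q) (first_hitE Qn nQ) ltry.
rewrite indicE memNset ?mulr0; first exact: cvg_payoff_unstopped.
by rewrite /= -[tau_minus X0 C (-1) t]/(first_hit Q) first_hit_never ?ltxx.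
Qed.

Hypotheses (p_sum1 : (\sum_(0 <= k <oo) (p k)%:E = 1)%E)
  (v_le1 : v <= 1) (w_le1 : w <= 1).

Lemma ruin_value_ge0 x : (0 <= ruin_value x)%E.
Proof.
by apply: value_ge0 => // [|z]; [exact: ltW | rewrite exprz_ge0// ltW].
Qed.

Lemma ruin_value_fin x : ruin_value x \is a fin_num.
Proof.
rewrite ge0_fin_numE ?ruin_value_ge0//; apply: le_lt_trans (ltry 1).
apply: value_le1 => //; first exact: ltW.
  by move=> z; rewrite exprz_ge0// ltW.
move=> [n|n]; rewrite /ruin_stop; first by lia.
by move=> _; rewrite NegzE opprK -exprnP exprn_ile1// ltW.
Qed.

(** The one-step equation, with the jump series split at x + 2: a jump of size
j >= x + 2 lands at x + 1 - j <= -1, where the value equals the reward. *)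
Lemma Psi_step (x : nat) :
  (Psi X0 C P v x%:Z w / v)%:E =
  ((\sum_(0 <= j < x.+2) p j * Psi X0 C P v (hop x%:Z j) w)%:E +
   \sum_(x.+1 <= k <oo) (w ^+ (k - x) * p k.+1)%:E)%E.
Proof.
have pV0 j : (0 <= (p j)%:E * ruin_value (hop x%:Z j))%E.
  by rewrite mule_ge0 ?lee_fin ?ruin_value_ge0.
have : ruin_value x%:Z = step_mean p v ruin_value x%:Z.
  apply: value_step => //; first exact: ltW.
  by move=> z; rewrite exprz_ge0// ltW.
rewrite /step_mean (nneseries_split 0 x.+2)// add0n.
have -> : (\sum_(x.+2 <= j <oo) (p j)%:E * ruin_value (hop x%:Z j) =
    \sum_(x.+1 <= k <oo) (w ^+ (k - x) * p k.+1)%:E)%E.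
  rewrite -(nneseries_addn x.+2)// -(nneseries_addn x.+1); last first.
    by move=> i; rewrite lee_fin mulr_ge0// exprn_ge0// ltW.
  apply: eq_eseriesr => i _.
  rewrite /ruin_value value_stop; last 2 first.
    by move=> z; rewrite exprz_ge0// ltW.
    by rewrite /ruin_stop /hop; lia.
  rewrite -EFinM mulrC addnS; congr (_ * _)%:E.
  by rewrite exprnP; congr (w ^ _); rewrite /hop; lia.
move=> VE; rewrite PsiE mulrC EFinM fineK ?ruin_value_fin// VE muleA -EFinM.
rewrite mulVf ?gt_eqF// mul1e -sumEFin; congr (_ + _)%E.
by apply: eq_bigr => j _; rewrite PsiE EFinM fineK ?ruin_value_fin.
Qed.

End PassageTimes.

(** * The relation for Z *)

Theorem mainTheorem3 (R : realType)
  (p : nat -> R)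
  (p_ge0 : forall k : nat, 0 <= p k)
  (p_sum1 : (\sum_(0 <= k <oo) (p k)%:E = 1)%E)
  (p0_gt0 : 0 < p 0%N)
  (d : measure_display) (T : measurableType d)
  (X0 : T -> int) (C : nat -> {mfun T >-> nat})
  (P : int -> probability T R)
  (X0_measurable : forall z : int, measurable (X0 @^-1` [set z]))
  (X0_start : forall x : int, P x (X0 @^-1` [set x]) = 1%E)
  (C_iid : forall x : int, iid_with_pmf (P x) C p)
  (v : R) (v_gt0 : 0 < v) (v_le1 : v <= 1)
  (w : R) (w_gt0 : 0 < w) (w_le1 : w <= 1)
  (x : nat) :
  (* in the first sum j = k + 1, so that k runs from -1 to x *)
  (Z X0 C P p v x%:Z w / v)%:E =
  ((\sum_(0 <= j < x.+2) p j * Z X0 C P p v (x%:Z - (j%:Z - 1)) w)%:E +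
   \sum_(x.+1 <= k <oo) (w ^+ (k - x) * p k.+1)%:E)%E.
Proof.
have ZE z : Z X0 C P p v z w =
    Psi X0 C P v z w + alpha X0 C P p v w * scale_fun p v z.
  by rewrite /Z (WE p_ge0).
rewrite ZE mulrDl -mulrA scale_fun_step// EFinD (Psi_step p_ge0)//.
rewrite addeAC -EFinD; congr (_%:E + _)%E.
rewrite mulr_sumr -big_split; apply: eq_bigr => j _ /=.
by rewrite ZE mulrDr (mulrCA (alpha _ _ _ _ _ _)).
Qed.
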